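(* Every extremal concept class $\mathcal{C}\subseteq\{0,1\}^n$ satisfies \[\lfloor \log_2 \mathtt{vc}(\mathcal{C})\rfloor \leq \mathtt{vc}^\star(\mathcal{C}) \leq 2\,\mathtt{vc}(\mathcal{C})+1.\]
   Context: A concept class is a subset $\mathcal{C}\subseteq\{0,1\}^n$; each $c\in\mathcal{C}$ is viewed as a function $c:[n]\to\{0,1\}$. $\mathcal{C}$ shatters $\{x_1,\dots,x_k\}\subseteq[n]$ if $\{(c(x_1),\dots,c(x_k)):c\in\mathcal{C}\}=\{0,1\}^k$ (the empty set is always shattered). $\mathtt{vc}(\mathcal{C})$ is the largest size of a set shattered by $\mathcal{C}$. $\mathcal{C}$ is extremal if $|\mathcal{C}|$ equals the number of subsets of $[n]$ shattered by $\mathcal{C}$. The dual class is $\mathcal{C}^\star=\{f_x:x\in[n]\}$ where $f_x:\mathcal{C}\to\{0,1\}$, $f_x(c)=c(x)$; the dual VC dimension is $\mathtt{vc}^\star(\mathcal{C})=\mathtt{vc}(\mathcal{C}^\star)$, i.e. the largest $k$ such that some $c_1,\dots,c_k\in\mathcal{C}$ satisfy: for every $S\subseteq[k]$ there is $x\in[n]$ with $c_i(x)=1$ iff $i\in S$. *)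

(* Defs.v *)
From mathcomp Require Import all_boot.

Set Implicit Arguments.
Unset Strict Implicit.
Unset Printing Implicit Defensive.

Definition concept_class (T : finType) := {set {ffun T -> bool}}.

(* Labellings of X are represented by restrictions of functions f on all of T.
   The first disjunct is the convention that the empty set is always shattered;
   it only matters when C is empty. *)
Definition shatters (T : finType) (C : concept_class T) (X : {set T}) : bool :=
  (X == set0) ||
  [forall f : {ffun T -> bool}, exists c in C, forall x in X, c x == f x].

Definition vc (T : finType) (C : concept_class T) : nat :=
  \max_(X : {set T} | shatters C X) #|X|.

Definition extremal (T : finType) (C : concept_class T) : Prop :=
  #|C| = #|[set X : {set T} | shatters C X]|.

Definition dual_class (T : finType) (C : concept_class T) :
    concept_class {c : {ffun T -> bool} | c \in C} :=
  [set [ffun c : {c : {ffun T -> bool} | c \in C} => val c x] | x : T].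

Definition dual_vc (T : finType) (C : concept_class T) : nat :=
  vc (dual_class C).

(* Main.v *)
(* The lower bound is the classical one: a shattered set of size 2^k indexes all
   labellings of k concepts.

   For the upper bound, let d = vc C.  The cubical complex of an extremal class C,
   and of its trace on any subcube, is acyclic mod 2 and has dimension at most d.
   If concepts c_i, i in [2d+2], realise all patterns in the dual, disjoint subsets
   of them span disjoint subcubes.  Acyclic carriers then give a chain map phi from
   the simplex on [2d+2] to the complex of C sending disjoint faces to disjoint
   chains, hence an equivariant chain map from the deleted product of the simplex
   (a sphere of dimension 2d with the antipodal action) to the deleted product of
   the complex.  Since phi vanishes above dimension d, the image of the fundamental
   cycle is zero, and a mod 2 Borsuk-Ulam argument gives a contradiction. *)

Require Import Defs.
From mathcomp Require Import all_boot.
From mathcomp Require Import all_algebra zify.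

Set Implicit Arguments.
Unset Strict Implicit.
Unset Printing Implicit Defensive.

Import GRing.Theory.
Local Open Scope ring_scope.

(** * Sums in [bool] as the field with two elements *)

Lemma addrr_bool (b : bool) : b + b = 0.
Proof. by case: b. Qed.

Lemma eq0_bool (b : bool) : ~ b -> b = 0.
Proof. by case: b. Qed.

Lemma addr_eq0_bool (a b : bool) : a + b = 0 -> a = b.
Proof. by case: a; case: b. Qed.

(** Orbits of size two cancel mod 2; comparing ranks picks one point from each. *)
Lemma sum_involution (I : finType) (t : I -> I) (F : I -> bool) :
  involutive t -> (forall i, F (t i) = F i) -> (forall i, t i = i -> F i = 0) ->
  \sum_i F i = 0.
Proof.
move=> tK Ft F0; pose r (i : I) : nat := enum_rank i.
rewrite (bigID (fun i => r i < r (t i))%N) /=.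
rewrite [X in _ + X](_ : _ = \sum_(i | (r (t i) < r i)%N) F i); last first.
  rewrite big_mkcond [RHS]big_mkcond; apply: eq_bigr => i _.
  rewrite -leqNgt leq_eqVlt; case: eqP => //= /val_inj/enum_rank_inj/F0 ->.
  by rewrite if_same.
rewrite [X in _ + X](reindex_inj (inv_inj tK)) /=.
under [X in _ + X]eq_bigl => i do rewrite tK.
by under [X in _ + X]eq_bigr => i _ do rewrite Ft; rewrite addrr_bool.
Qed.

Lemma andb_sumr (I : finType) (P : pred I) (b : bool) (F : I -> bool) :
  b && (\sum_(i | P i) F i) = \sum_(i | P i) (b && F i).
Proof. by case: b => //=; rewrite big1. Qed.

Lemma sum_bool_exists (I : finType) (P : pred I) (F : I -> bool) :
  \sum_(i | P i) F i -> exists2 i, P i & F i.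
Proof.
move=> h; apply/exists_inP; apply: contraLR h => /exists_inPn h.
by rewrite big1 // => i /h/negbTE.
Qed.

Lemma andb_suml (I : finType) (P : pred I) (F : I -> bool) (b : bool) :
  (\sum_(i | P i) F i) && b = \sum_(i | P i) (F i && b).
Proof. by rewrite andbC andb_sumr; apply: eq_bigr => i _; rewrite andbC. Qed.

(** * Shattering and ample classes: restrictions and links *)

Section Extremal.

Variable T : finType.
Implicit Types (C D : concept_class T) (x : T) (c : {ffun T -> bool}).

Definition flip x c : {ffun T -> bool} := [ffun y => (y == x) (+) c y].

Lemma flipK x : involutive (flip x).
Proof. by move=> c; apply/ffunP => y; rewrite !ffunE; case: (y == x); case: (c y). Qed.

Lemma flipx x c : flip x c x = ~~ c x.
Proof. by rewrite ffunE eqxx. Qed.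

Lemma flip_neq x y c : y != x -> flip x c y = c y.
Proof. by rewrite ffunE => /negbTE ->. Qed.

(** Unlike in [shatters], the empty set gets no exception: the empty class shatters nothing, so it
    is [ample], and ampleness can pass to restrictions that happen to be empty. *)
Definition shset C : {set {set T}} :=
  [set X : {set T} |
    [forall f : {ffun T -> bool}, exists c in C, forall x in X, c x == f x]].

Lemma shsetP C (X : {set T}) :
  reflect (forall f : {ffun T -> bool},
             exists2 c, c \in C & forall x, x \in X -> c x = f x)
          (X \in shset C).
Proof.
rewrite inE; apply: (iffP forallP) => [h f | h f].
  by have /exists_inP[c cC /forall_inP cf] := h f; exists c => // x /cf/eqP.
have [c cC cf] := h f; apply/exists_inP; exists c => //.
by apply/forall_inP => x /cf ->.
Qed.

Lemma shset_const C (X : {set T}) x b :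
  (forall c, c \in C -> c x = b) -> X \in shset C -> x \notin X.
Proof.
move=> Cb /shsetP/(_ [ffun => ~~ b])[c /Cb cb cf].
by apply/negP => /cf; rewrite cb ffunE; case: (b).
Qed.

Definition restr x b C : concept_class T := [set c in C | c x == b].

Lemma card_restr x C : #|C| = (#|restr x false C| + #|restr x true C|)%N.
Proof.
rewrite -(cardsID [set c : {ffun T -> bool} | c x] C) addnC; congr (_ + _)%N.
  by apply: eq_card => c; rewrite !inE andbC eqbF_neg.
by apply: eq_card => c; rewrite !inE eqb_id.
Qed.

Lemma card_image_setU1 x (A : {set {set T}}) :
  (forall X, X \in A -> x \notin X) -> #|[set x |: X | X in A]| = #|A|.
Proof.
move=> Ax; apply: card_in_imset => X Y /Ax xX /Ax xY e.
by rewrite -(setU1K xX) -(setU1K xY) e.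
Qed.

(** Members of [B] are counted after adding [x], hence differ from those of [A]. Both ways of
    cutting [C] along [x], into two restrictions and into [proj] and [link], rely on this count. *)
Lemma leq_card_shset C x (A B : {set {set T}}) :
  (forall X, X \in A -> x \notin X /\ X \in shset C) ->
  (forall X, X \in B -> x \notin X /\ x |: X \in shset C) ->
  (#|A| + #|B| <= #|shset C|)%N.
Proof.
move=> hA hB; rewrite -(@card_image_setU1 x B); last by move=> X /hB[].
rewrite -cardsUI [X in (_ + X)%N](_ : _ = 0%N) ?addn0.
  by apply/subset_leq_card/subsetP => X /setUP[/hA[]//|/imsetP[Y /hB[_ ?] ->]].
apply/eqP; rewrite cards_eq0; apply/eqP/setP => X; rewrite !inE.
apply/negP => /andP[/hA[xX _] /imsetP[Y _ eX]].
by move: xX; rewrite eX setU11.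
Qed.

Lemma shsetS C D (X : {set T}) : C \subset D -> X \in shset C -> X \in shset D.
Proof.
move=> /subsetP sCD /shsetP h; apply/shsetP => f.
by have [c /sCD cD cf] := h f; exists c.
Qed.

Lemma restr_sub x b C : restr x b C \subset C.
Proof. by apply/subsetP => c; rewrite inE => /andP[]. Qed.

Lemma shset_restr C x b (X : {set T}) :
  X \in shset (restr x b C) -> x \notin X /\ X \in shset C.
Proof.
move=> h; split; last exact: shsetS (restr_sub x b C) h.
by apply: (shset_const (b := b)) h => c; rewrite inE => /andP[_ /eqP].
Qed.

(** A set shattered by both halves is counted a second time with [x] added, since the halves supply
    both values at [x]. *)
Lemma card_shset_restr C x :
  (#|shset (restr x false C)| + #|shset (restr x true C)| <= #|shset C|)%N.
Proof.
rewrite -cardsUI; apply: (@leq_card_shset C x).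
  by move=> X /setUP[]; apply: shset_restr.
move=> X /setIP[h0 h1]; have [xX _] := shset_restr h0; split=> //.
apply/shsetP => f.
have [c cC cf]: exists2 c, c \in restr x (f x) C & forall y, y \in X -> c y = f y.
  by case: (f x); [move/shsetP: h1 | move/shsetP: h0]; apply.
move: cC; rewrite inE => /andP[cC /eqP cx]; exists c => // y.
by case/setU1P => [->|/cf].
Qed.

(* Pajor's inequality. *)
Lemma card_le_shset C : (#|C| <= #|shset C|)%N.
Proof.
have [m] := ubnP #|C|; elim: m C => // m IH C ltCm.
case: (boolP [exists x, (restr x false C != set0) && (restr x true C != set0)]).
  case/existsP => x /andP[]; rewrite -!card_gt0 => p0 p1.
  have := card_restr x C; have := card_shset_restr C x.
  have := IH (restr x false C); have := IH (restr x true C); lia.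
rewrite negb_exists => /forallP h.
have [->|[c cC]] := set_0Vmem C; first by rewrite cards0.
have -> : C = [set c].
  apply/setP => c'; rewrite !inE; apply/idP/eqP => [c'C|-> //].
  apply/ffunP => x; have := h x; rewrite negb_and !negbK.
  by case cx: (c x); case c'x: (c' x) => //;
    case/orP => /eqP/setP e; move: (e c) (e c');
    rewrite !inE cx c'x cC c'C.
rewrite cards1 card_gt0; apply/set0Pn; exists set0; apply/shsetP => f.
by exists c; rewrite ?set11 // => x; rewrite inE.
Qed.

(* [extremal] up to the convention on the empty class. *)
Definition ample C := #|C| = #|shset C|.

(** Pajor's inequality for the two halves and [card_shset_restr] form a chain from [#|C|] to
    [#|shset C|]; equality of its ends forces equality in each half. *)
Lemma ample_restr x b C : ample C -> ample (restr x b C).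
Proof.
rewrite /ample => e; have := card_restr x C; have := card_shset_restr C x.
have := card_le_shset (restr x false C); have := card_le_shset (restr x true C).
by case: b; lia.
Qed.

Lemma ample_restr_set C (A : {set T}) (v : {ffun T -> bool}) :
  ample C -> ample [set c in C | [forall x in A, c x == v x]].
Proof.
move=> aC; rewrite -[A]set_enum; elim: (enum A) => [|x s IH].
  suff -> : [set c in C | [forall x in [set:: [::]], c x == v x]] = C by [].
  apply/setP => c; rewrite inE andb_idr // => _.
  by apply/forall_inP => x; rewrite inE.
rewrite (_ : [set c in C | _] =
  restr x (v x) [set c in C | [forall x in [set:: s], c x == v x]]).
  exact: ample_restr.
apply/setP => c; rewrite !inE -andbA; congr (_ && _).
apply/forall_inP/andP => [h|[/forall_inP h hx] y].
  split; last by apply: h; rewrite !inE eqxx.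
  by apply/forall_inP => y ys; apply: h; move: ys; rewrite !inE => ->; rewrite orbT.
by rewrite inE in_cons => /orP[/eqP -> //|ys]; apply: h; rewrite inE.
Qed.

(** The edges of [C] in direction [x], each represented by its end with value false at [x], so that
    the ground set remains [T]. The projection [proj] along [x] uses the same normalisation. *)
Definition link x C : concept_class T :=
  [set c in C | ~~ c x & flip x c \in C].

Definition proj x C : concept_class T :=
  [set c : {ffun T -> bool} | ~~ c x & (c \in C) || (flip x c \in C)].

(** Flipping the true half onto the false half gives two sets whose union is [proj] and whose
    intersection is [link]. *)
Lemma card_proj_link x C : #|C| = (#|proj x C| + #|link x C|)%N.
Proof.
rewrite (card_restr x).
rewrite -(card_imset (mem (restr x true C)) (inv_inj (flipK x))) -[LHS]cardsUI.
congr (_ + _)%N; apply: eq_card => c; rewrite !inE.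
  apply/orP/andP => [[/andP[cC /eqP->]|/imsetP[c' + ->]]|[cx /orP[cC|fC]]].
  - by rewrite cC.
  - by rewrite !inE flipx flipK => /andP[-> /eqP ->]; rewrite orbT.
  - by left; rewrite cC (negbTE cx).
  - right; apply/imsetP; exists (flip x c); last by rewrite flipK.
    by rewrite inE fC flipx cx.
apply/andP/andP => [[/andP[cC /eqP cx] /imsetP[c' + e]]|[cC /andP[cx fC]]].
  by rewrite inE cC cx e flipK => /andP[-> _].
split; first by rewrite cC (negbTE cx).
apply/imsetP; exists (flip x c); last by rewrite flipK.
by rewrite inE fC flipx cx.
Qed.

Lemma shset_proj x C (X : {set T}) :
  X \in shset (proj x C) -> x \notin X /\ X \in shset C.
Proof.
move=> h; have xX : x \notin X.
  by apply: (shset_const (b := false)) h => c; rewrite inE => /andP[/negbTE].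
split=> //; apply/shsetP => f; have /shsetP/(_ f)[c] := h.
rewrite inE => /andP[_ /orP[cC|fC]] cf; first by exists c.
exists (flip x c) => // y yX; rewrite flip_neq ?cf //.
by apply: contraNneq xX => <-.
Qed.

Lemma shset_link x C (X : {set T}) :
  X \in shset (link x C) -> x \notin X /\ x |: X \in shset C.
Proof.
move=> h; have xX : x \notin X.
  by apply: (shset_const (b := false)) h => c; rewrite inE => /and3P[_ /negbTE].
split=> //; apply/shsetP => f; have /shsetP/(_ f)[c] := h.
rewrite inE => /and3P[cC /negbTE cx fC] cf.
have nx y : y \in X -> y != x by move=> yX; apply: contraNneq xX => <-.
case fx: (f x); [exists (flip x c) | exists c] => // y /setU1P[->|yX].
- by rewrite flipx cx fx.
- by rewrite flip_neq ?nx ?cf.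
- by rewrite cx fx.
- exact: cf.
Qed.

Lemma ample_link x C : ample C -> ample (link x C).
Proof.
rewrite /ample => e; have := card_proj_link x C.
have := leq_card_shset (@shset_proj x C) (@shset_link x C).
have := card_le_shset (link x C); have := card_le_shset (proj x C); lia.
Qed.

(** With an empty link, [C] has as many elements as [proj x C], which shatters at least that many
    sets, all avoiding [x]. The singleton of [x] is then one shattered set too many. *)
Lemma link_neq0 x C :
  ample C -> restr x false C != set0 -> restr x true C != set0 -> link x C != set0.
Proof.
move=> aC /set0Pn[c0]; rewrite inE => /andP[c0C /eqP c0x].
move=> /set0Pn[c1]; rewrite inE => /andP[c1C /eqP c1x].
apply/negP => /eqP l0; have := card_proj_link x C; rewrite l0 cards0 addn0 => e.
have := @leq_card_shset C x (shset (proj x C)) [set set0] (@shset_proj x C).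
rewrite cards1 -aC e addn1 ltnNge card_le_shset => h; apply/notF/h => X /set1P ->.
rewrite inE; split=> //; apply/shsetP => f.
case fx: (f x); [exists c1 | exists c0] => // y;
  by rewrite !inE orbF => /eqP ->; rewrite fx.
Qed.

End Extremal.

(** * Mod 2 chains of cubes and acyclicity of ample classes *)

Section CubicalChains.

Variable T : finType.
Implicit Types (C D : concept_class T) (x y : T) (c : {ffun T -> bool}).

(* A subcube of {0,1}^T; [None] marks the free coordinates. *)
Definition cube := {ffun T -> option bool}.
Implicit Types (q : cube) (a b : cube -> bool).

Definition upd q x (v : option bool) : cube := [ffun y => if y == x then v else q y].

Lemma updx q x v : upd q x v x = v.
Proof. by rewrite ffunE eqxx. Qed.

Lemma upd_neq q x y v : y != x -> upd q x v y = q y.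
Proof. by rewrite ffunE => /negbTE ->. Qed.

Lemma updC q x y v w : x != y -> upd (upd q x v) y w = upd (upd q y w) x v.
Proof.
move=> xy; apply/ffunP => z; rewrite !ffunE.
by case: eqP => // ->; rewrite eq_sym (negbTE xy).
Qed.

Lemma upd_upd q x v w : upd (upd q x v) x w = upd q x w.
Proof. by apply/ffunP => z; rewrite !ffunE; case: eqP. Qed.

Lemma upd_id q x v : q x = v -> upd q x v = q.
Proof. by move=> e; apply/ffunP => z; rewrite !ffunE; case: eqP => // ->. Qed.

Definition vertex c : cube := [ffun x => Some (c x)].

Definition in_cube q c := forall x v, q x = Some v -> c x = v.

Definition cubical C q := forall c, in_cube q c -> c \in C.

Definition carried C a := forall q, a q -> cubical C q.

(* Chains are mod 2 and not graded; a cell receives its cofaces. *)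
Definition bd a q : bool := \sum_(x | q x != None) a (upd q x None).

Definition aug a : bool := \sum_c a (vertex c).

Lemma eq_bd a b : a =1 b -> bd a =1 bd b.
Proof. by move=> ab q; apply: eq_bigr => x _; rewrite ab. Qed.

Lemma eq_aug a b : a =1 b -> aug a = aug b.
Proof. by move=> ab; apply: eq_bigr => x _; rewrite ab. Qed.

Lemma bdD a b q : bd (fun r => a r + b r) q = bd a q + bd b q.
Proof. exact: big_split. Qed.

Lemma augD a b : aug (fun r => a r + b r) = aug a + aug b.
Proof. exact: big_split. Qed.

Lemma bd0 q : bd (fun=> 0) q = 0.
Proof. exact: big1. Qed.

(** Two coordinates can be freed in either order; the pair of twice the same coordinate never
    occurs. *)
Lemma bdbd a q : bd (bd a) q = 0.
Proof.
rewrite /bd pair_big_dep big_mkcond /=.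
apply: (sum_involution (t := fun p => (p.2, p.1))) => [[] //|[x y]|[x y] [-> _]] /=.
  have [->//|xy] := eqVneq x y.
  by rewrite !upd_neq // 1?eq_sym // andbC updC 1?eq_sym.
by rewrite updx andbF.
Qed.

Lemma upd_vertex_flip c x : upd (vertex (flip x c)) x None = upd (vertex c) x None.
Proof. by apply/ffunP => y; rewrite !ffunE; case: eqP. Qed.

(** The two ends of an edge in direction [x] are exchanged by [flip x]. *)
Lemma aug_bd a : aug (bd a) = 0.
Proof.
rewrite /aug /bd.
under eq_bigr => c _ do under eq_bigl => x do rewrite ffunE.
rewrite exchange_big big1 // => x _.
apply: (sum_involution (t := flip x)) (flipK x) _ _ => [c|c /ffunP/(_ x)].
  by rewrite upd_vertex_flip.
by rewrite flipx; case: (c x).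
Qed.

Definition slice x v a q := (q x == Some v) && a q.

Lemma bd_slice x v a q :
  bd (slice x v a) q = (q x == Some v) && (bd a q + a (upd q x None)).
Proof.
rewrite /slice; case: eqP => [qx|qx] /=; last first.
  rewrite /bd big1 // => y _; have [->|xy] := eqVneq x y; first by rewrite updx.
  by rewrite upd_neq //; case: eqP.
rewrite /bd (bigD1 x) /= ?qx // updx /= add0r [X in X + _](bigD1 x) /= ?qx //.
rewrite addrAC addrr_bool add0r; apply: eq_bigr => y /andP[_ yx].
by rewrite upd_neq 1?eq_sym // qx eqxx.
Qed.

Lemma aug_slice x v a :
  aug (slice x v a) = \sum_(c : {ffun T -> bool} | c x == v) a (vertex c).
Proof.
rewrite /aug [RHS]big_mkcond; apply: eq_bigr => c _.
by rewrite /slice ffunE; case: (c x) v => [] [].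
Qed.

Lemma aug_slices x a : aug (slice x false a) + aug (slice x true a) = aug a.
Proof.
rewrite -augD; apply: eq_bigr => c _; rewrite /slice ffunE.
by case: (c x); case: (a _).
Qed.

Lemma bd_upd x v a q :
  bd (fun r => a (upd r x v)) q =
  ((q x != None) && a (upd q x v)) + ((v != None) && a (upd q x None))
  + bd a (upd q x v).
Proof.
have sumD1 (P : pred T) (F : T -> bool) : \sum_(y | P y) F y =
    (P x && F x) + \sum_(y | y != x) (P y && F y).
  by rewrite big_mkcond (bigD1 x) //=; congr (_ + _); apply: eq_bigr.
rewrite /bd sumD1 [X in _ = _ + X]sumD1 updx !upd_upd -addrA; congr (_ + _).
rewrite addrA addrr_bool add0r; apply: eq_bigr => y yx.
by rewrite upd_neq // updC.
Qed.

Definition prism x a q := (q x == None) && a (upd q x (Some false)).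

(** The usual prism formula: a copy of [a] at each end and a prism over its boundary. In the first
    branch, [a (upd q x None)] cancels the summand of [bd a] in direction [x]. *)
Lemma bd_prism x a q :
  bd (prism x a) q =
  if q x == None then a (upd q x None) + bd a (upd q x (Some false))
  else a (upd q x (Some false)).
Proof.
rewrite /prism; case: eqP => [qx|/eqP qx].
  transitivity (bd (fun r => a (upd r x (Some false))) q); last first.
    by rewrite bd_upd qx /= add0r.
  apply: eq_bigr => y qy; rewrite upd_neq ?qx //.
  by apply: contraNneq qy => <-; rewrite qx.
rewrite /bd (bigD1 x) //= updx upd_upd /= big1 ?addr0 // => y /andP[_ yx].
by rewrite eq_sym in yx; rewrite upd_neq // (negbTE qx).
Qed.

Lemma cubical_sub C D q : C \subset D -> cubical C q -> cubical D q.
Proof. by move=> /subsetP sCD h c /h/sCD. Qed.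

Lemma cubical_face C q x v : cubical C (upd q x None) -> cubical C (upd q x v).
Proof.
move=> h c cq; apply: h => y w; have [->|yx] := eqVneq y x; first by rewrite updx.
by rewrite upd_neq // -(@upd_neq q x y v) //; apply: cq.
Qed.

Lemma cubical_restr C q x v : cubical C q -> q x = Some v -> cubical (restr x v C) q.
Proof. by move=> h qx c cq; rewrite inE h // (cq _ _ qx) eqxx. Qed.

(** Were [x] free in [q], some vertex of [q] would have the value [~~ v] at [x]. *)
Lemma cubical_const C q x v :
  cubical C q -> (forall c, c \in C -> c x = v) -> q x = Some v.
Proof.
move=> h Cv; case qx: (q x) => [w|].
  congr Some; rewrite -(Cv [ffun y => odflt false (q y)]) ?ffunE ?qx //.
  by apply: h => y u; rewrite ffunE => ->.
have /Cv : [ffun y => odflt (~~ v) (q y)] \in C.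
  by apply: h => y u; rewrite ffunE => ->.
by rewrite ffunE qx /=; case: (v).
Qed.

Lemma cubical_link C q x :
  q x = Some false -> cubical (link x C) q <-> cubical C (upd q x None).
Proof.
move=> qx; split=> h c cq.
  have hq c' : c' x = false -> (forall y, y != x -> c' y = c y) -> c' \in link x C.
    move=> c'x c'c; apply: h => y u; have [->|yx] := eqVneq y x.
      by rewrite qx c'x => -[].
    by move=> qy; rewrite c'c //; apply: cq; rewrite upd_neq.
  case cx: (c x).
    have := hq (flip x c); rewrite flipx cx inE flipK => /(_ erefl) h'.
    by have /and3P[] : [&& flip x c \in C, ~~ flip x c x & c \in C]
      by apply: h' => y; apply: flip_neq.
  by have := hq c cx (fun _ _ => erefl); rewrite inE => /and3P[].
have cx : c x = false by apply: cq.
have hc (d : {ffun T -> bool}) : (forall y, y != x -> d y = c y) -> d \in C.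
  move=> dc; apply: h => y u; have [->|yx] := eqVneq y x; first by rewrite updx.
  by rewrite upd_neq // dc //; apply: cq.
by rewrite inE cx !hc // => y; apply: flip_neq.
Qed.

Lemma in_cube_vertex c c' : in_cube (vertex c) c' -> c' = c.
Proof. by move=> h; apply/ffunP => x; apply: h; rewrite ffunE. Qed.

Lemma cubical_vertex C c : cubical C (vertex c) <-> c \in C.
Proof.
split=> [h|cC c' /in_cube_vertex -> //].
by apply: h => x v; rewrite ffunE => -[].
Qed.

Lemma carriedD C a b : carried C a -> carried C b -> carried C (fun q => a q + b q).
Proof.
move=> ha hb q; case aq: (a q); first by move=> _; apply: ha.
by case bq: (b q) => // _; apply: hb.
Qed.

Lemma carried_sub C D a : C \subset D -> carried C a -> carried D a.
Proof. by move=> sCD h q /h; apply: cubical_sub. Qed.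

Lemma vertex_inj : injective vertex.
Proof.
by move=> c c' /ffunP e; apply/ffunP => x; have := e x; rewrite !ffunE => -[].
Qed.

Lemma bd_vertex c q : bd (pred1 (vertex c)) q = 0.
Proof.
rewrite /bd big1 // => x _ /=; apply: eq0_bool => /eqP/ffunP/(_ x).
by rewrite updx ffunE.
Qed.

Lemma aug_vertex c : aug (pred1 (vertex c)) = 1.
Proof.
rewrite /aug (bigD1 c) //= eqxx big1 // => c' /negbTE cc'.
by rewrite (inj_eq vertex_inj) cc'.
Qed.

Lemma carried_vertex C c : c \in C -> carried C (pred1 (vertex c)).
Proof. by move=> cC q /= /eqP ->; apply/cubical_vertex. Qed.

(** At most one concept is left, so the only possible cell is its vertex, which [aug] detects. *)
Lemma carried_constant C a :
  (forall x, exists v, forall c, c \in C -> c x = v) ->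
  carried C a -> aug a = 0 -> a =1 (fun=> 0).
Proof.
move=> Ck ha a0 q; apply: contra_eqF a0 => aq; have hq := ha _ aq.
pose c : {ffun T -> bool} := [ffun x => odflt false (q x)].
have cx x c' : c' \in C -> q x = Some (c' x).
  have [v Cv] := Ck x => c'C; rewrite (Cv c' c'C).
  exact: cubical_const hq Cv.
have cC : c \in C by apply: hq => x v e; rewrite ffunE e.
have qE : q = vertex c by apply/ffunP => x; rewrite (cx x c cC) [RHS]ffunE.
rewrite qE in aq; rewrite /aug (bigD1 c) //= aq big1 // => c' c'c.
apply: eq0_bool => /ha/cubical_vertex c'C.
case/eqP: c'c; apply/ffunP => x; have := cx x _ c'C; rewrite (cx x c cC).
by case.
Qed.

(** Vanishing of reduced mod 2 homology, in Mayer-Vietoris style: the complex of [C] consists of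
    those of its two halves along [x], joined by a prism over the link. All three pieces are smaller
    ample classes. The link serves to remove the cells of [a] crossing [x], and the remaining cycles
    are filled in the halves. *)
Lemma ample_acyclic C a :
  ample C -> carried C a -> bd a =1 (fun=> 0) -> aug a = 0 ->
  exists2 b, carried C b & bd b =1 a.
Proof.
have [m] := ubnP #|C|; elim: m C a => // m IH C a ltCm aC ha bda auga.
case: (boolP [exists x, (restr x false C != set0) && (restr x true C != set0)]);
  last first.
  rewrite negb_exists => /forallP h; exists (fun=> 0) => // q.
  rewrite bd0 (@carried_constant C a) // => x.
  have := h x; rewrite negb_and !negbK => /orP[] /eqP/setP e.
    exists true => c cC; have := e c; rewrite !inE cC.
    by case: (c x).
  exists false => c cC; have := e c; rewrite !inE cC.
  by case: (c x).
case/existsP => x /andP[n0 n1].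
have [v vL] := set0Pn _ (link_neq0 aC n0 n1).
have ltC w : (#|restr x w C| < m)%N.
  move: n0 n1; rewrite -!card_gt0; have := card_restr x C; case: w; lia.
have ltL : (#|link x C| < m)%N.
  apply: leq_ltn_trans (ltC false); apply: subset_leq_card.
  by apply/subsetP => c; rewrite !inE => /and3P[-> /negbTE ->].
(* The cells of [a] crossing the direction [x] form a cycle of the link. *)
pose p := slice x false (fun q => a (upd q x None)).
have hp : carried (link x C) p.
  by move=> q /andP[/eqP qx /ha]; rewrite cubical_link.
have bdp : bd p =1 (fun=> 0).
  move=> q; rewrite bd_slice bd_upd upd_upd bda /= addr0; case: eqP => //= ->.
  by rewrite /= addr0 addrr_bool.
(* The vertices of [p] correspond under [flip x] to those of the boundary of [slice x true a]. *)
have augp : aug p = 0.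
  have e : bd (slice x true a) =1 slice x true (fun q => a (upd q x None)).
    by move=> q; rewrite bd_slice bda add0r.
  rewrite -(aug_bd (slice x true a)) (eq_aug e).
  rewrite !aug_slice (reindex_inj (inv_inj (flipK x))) /=.
  by apply: eq_big => c; rewrite ?flipx ?upd_vertex_flip //; case: (c x).
have [r0 hr0 bdr0] := IH _ _ ltL (ample_link x aC) hp bdp augp.
(* Adding the vertex [v] changes the augmentation of the filling but not its boundary. The chosen
   value makes the false half of [a'] below have augmentation zero; the true half then follows from
   the total. *)
have [r hr [bdr augr]] : exists2 r, carried (link x C) r & bd r =1 p /\
    aug r = aug (slice x false a).
  case e: (aug r0 == aug (slice x false a)).
    by exists r0 => //; split=> //; apply/eqP.
  exists (fun q => r0 q + pred1 (vertex v) q); last split=> [q|].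
  - by apply: carriedD => //; apply: carried_vertex.
  - by rewrite bdD bd_vertex bdr0 addr0.
  - by rewrite augD aug_vertex; case: (aug r0) (aug (slice x false a)) e => [] [].
have hrx q : r q -> q x = Some false.
  by move=> /hr/cubical_const; apply => c; rewrite inE => /and3P[_ /negbTE].
have rN q : r (upd q x None) = false.
  by apply: eq0_bool => /hrx; rewrite updx.
(* This cycle differs from [a] by a boundary and has no cell crossing [x], so each of its two slices
   is a cycle. *)
pose a' q := a q + bd (prism x r) q.
have a'N q : q x = None -> a' q = 0.
  move=> qx; rewrite /a' bd_prism qx eqxx rN add0r bdr /p /slice updx eqxx /=.
  by rewrite upd_upd upd_id // addrr_bool.
have bda' : bd a' =1 (fun=> 0).
  by move=> q; rewrite bdD bda bdbd addr0.
have hprism : carried C (prism x r).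
  move=> q /andP[/eqP qx /hr]; rewrite cubical_link ?updx // upd_upd upd_id //.
have ha' w : carried (restr x w C) (slice x w a').
  move=> q /andP[/eqP qx]; rewrite /a' bd_prism qx /= => e.
  apply: cubical_restr => //; case aq: (a q); first exact: ha.
  have : r (upd q x (Some false)) by move: e; rewrite aq.
  move=> /hr; rewrite cubical_link ?updx // upd_upd => /cubical_face.
  by move/(_ (Some w)); rewrite upd_id.
have bds w : bd (slice x w a') =1 (fun=> 0).
  by move=> q; rewrite bd_slice bda' a'N ?updx // andbF.
have aug0 : aug (slice x false a') = 0.
  rewrite (eq_aug (b := fun q => slice x false a q + r q)); last first.
    move=> q; rewrite /slice /a' bd_prism; case: eqP => [qx|qx] /=.
      by rewrite qx /= upd_id.
    by case rq: (r q) => //; case: qx; apply: hrx.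
  by rewrite augD augr addrr_bool.
have aug1 : aug (slice x true a') = 0.
  have := aug_slices x a'; rewrite aug0 add0r => ->.
  by rewrite augD auga aug_bd.
have [b0 hb0 bdb0] := IH _ _ (ltC false) (ample_restr x false aC) (ha' _) (bds _) aug0.
have [b1 hb1 bdb1] := IH _ _ (ltC true) (ample_restr x true aC) (ha' _) (bds _) aug1.
exists (fun q => b0 q + b1 q + prism x r q).
  by apply: carriedD hprism; apply: carriedD;
    [apply: carried_sub hb0 | apply: carried_sub hb1]; apply: restr_sub.
move=> q; rewrite !bdD bdb0 bdb1 /slice.
case qx: (q x) => [[]|] /=.
- by rewrite add0r /a' -addrA addrr_bool addr0.
- by rewrite addr0 /a' -addrA addrr_bool addr0.
- by apply/esym/addr_eq0_bool; rewrite add0r; apply: a'N.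
Qed.

End CubicalChains.

(** * Reindexing sums over subsets and complements *)

Section SubsetSums.

Variable I : finType.
Implicit Types (U s : {set I}) (F : {set I} -> {set I} -> bool).

Lemma sum_subset_compl U F :
  \sum_(s : {set I} | s \subset U) F s (U :\: s) =
  \sum_(s : {set I} | s \subset U) F (U :\: s) s.
Proof.
have DK s : s \subset U -> U :\: (U :\: s) = s.
  by move=> sU; rewrite setDDr setDv set0U; apply/setIidPr.
rewrite (reindex_onto (fun s => U :\: s) (fun s => U :\: s)); last by move=> s /DK.
apply: eq_big => [s|s /andP[_ /eqP -> //]].
rewrite subsetDl /=; apply/eqP/idP => [<-|/DK //].
exact: subsetDl.
Qed.

(** Both sides run over the partitions of [U] into a set, a marked point and a second set. *)
Lemma sum_subset_remove U F :
  \sum_(s : {set I} | s \subset U) \sum_(i in s) F (s :\ i) (U :\: s) =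
  \sum_(i in U) \sum_(s : {set I} | s \subset U :\ i) F s ((U :\ i) :\: s).
Proof.
rewrite (exchange_big_dep (mem U)) /=; last by move=> s i /subsetP sU /sU.
apply: eq_bigr => i iU.
rewrite (reindex_onto (fun s => i |: s) (fun s => s :\ i)) /=; last first.
  by move=> s /andP[_ iS]; rewrite setD1K.
apply: eq_big => [s|s /andP[_ /eqP e]]; last by rewrite e -setDDl.
rewrite setU11 andbT subUset sub1set iU /= subsetD1; congr (_ && _).
apply/eqP/idP => [<-|]; first by rewrite !inE eqxx.
exact: setU1K.
Qed.

End SubsetSums.

(** * Dimension of cubes and acyclic carriers *)

Section Carrier.

Variable T : finType.
Implicit Types (C : concept_class T) (x y : T) (q : cube T) (a b : cube T -> bool).

Definition cube_dim q := #|[set x | q x == None]|.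

Lemma dim_upd q x : q x != None -> cube_dim (upd q x None) = (cube_dim q).+1.
Proof.
move=> qx; rewrite /cube_dim; have -> : [set y | upd q x None y == None] =
    x |: [set y | q y == None].
  apply/setP => y; rewrite !inE; have [->|yx] := eqVneq y x.
    by rewrite updx.
  by rewrite upd_neq.
by rewrite cardsU1 inE qx.
Qed.

(** The free coordinates of [q] are shattered: any labelling of them is completed by the fixed
    values of [q]. *)
Lemma cubical_dim_vc C q : cubical C q -> (cube_dim q <= vc C)%N.
Proof.
move=> h; apply: (@leq_bigmax_cond _ _ (fun X : {set T} => #|X|)).
apply/orP; right; apply/forallP => f.
apply/exists_inP; exists [ffun x => if q x is Some v then v else f x].
  by apply: h => x v; rewrite ffunE => ->.
by apply/forall_inP => x; rewrite inE ffunE => /eqP ->.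
Qed.

Lemma bd_sum (J : finType) (P : pred J) (F : J -> cube T -> bool) q :
  bd (fun r => \sum_(i | P i) F i r) q = \sum_(i | P i) bd (F i) q.
Proof. exact: exchange_big. Qed.

Lemma aug_sum (J : finType) (P : pred J) (F : J -> cube T -> bool) :
  aug (fun r => \sum_(i | P i) F i r) = \sum_(i | P i) aug (F i).
Proof. exact: exchange_big. Qed.

(** Chains are ungraded, so the filling is truncated to dimension [m.+1]; since [bd] is homogeneous
    and [a] lives in dimension [m], the boundary does not change. *)
Lemma ample_acyclic_dim C a m :
  ample C -> carried C a -> (forall q, a q -> cube_dim q = m) ->
  bd a =1 (fun=> 0) -> aug a = 0 ->
  exists b, [/\ carried C b, forall q, b q -> cube_dim q = m.+1 & bd b =1 a].
Proof.
move=> aC ha da bda auga; have [b hb bdb] := ample_acyclic aC ha bda auga.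
exists (fun q => (cube_dim q == m.+1) && b q).
split=> [q /andP[_ /hb] //|q /andP[/eqP] //|q].
have -> : bd (fun q => (cube_dim q == m.+1) && b q) q = (cube_dim q == m) && bd b q.
  by rewrite /bd andb_sumr; apply: eq_bigr => x qx; rewrite dim_upd // eqSS.
by rewrite bdb; case: eqP => //= dq; apply/esym/eq0_bool => /da.
Qed.

Variables (k : nat) (C : concept_class T) (c : 'I_k -> {ffun T -> bool}).
Hypotheses (aC : ample C) (cC : forall i, c i \in C).
Implicit Types (s t : {set 'I_k}).

(* The part of [C] in the smallest subcube containing the [c i], [i \in s]. *)
Definition hull s : concept_class T :=
  [set d in C | [forall x, forall v, [forall i in s, c i x == v] ==> (d x == v)]].

Lemma hullP s d :
  reflect (d \in C /\ forall x v, (forall i, i \in s -> c i x = v) -> d x = v)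
          (d \in hull s).
Proof.
rewrite inE; apply: (iffP andP) => -[dC h]; split=> //.
  move=> x v hv; have /forallP/(_ x)/forallP/(_ v)/implyP h' := h.
  by apply/eqP/h'/forall_inP => i /hv ->.
apply/forallP => x; apply/forallP => v; apply/implyP => /forall_inP hv.
by apply/eqP/h => i /hv/eqP.
Qed.

Lemma hullS s t : s \subset t -> hull s \subset hull t.
Proof.
move=> /subsetP st; apply/subsetP => d /hullP[dC h]; apply/hullP; split=> // x v hv.
by apply: h => i /st/hv.
Qed.

Lemma hull_sub s : hull s \subset C.
Proof. by apply/subsetP => d /hullP[]. Qed.

Lemma mem_hull s i : i \in s -> c i \in hull s.
Proof. by move=> si; apply/hullP; split=> // x v; apply. Qed.

Lemma ample_hull s : s != set0 -> ample (hull s).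
Proof.
case/set0Pn => j js; pose A := [set x | [forall i in s, c i x == c j x]].
suff -> : hull s = [set d in C | [forall x in A, d x == c j x]].
  exact: ample_restr_set.
apply/setP => d; rewrite [RHS]inE.
apply/hullP/andP => -[dC h]; split=> //.
  apply/forall_inP => x; rewrite inE => /forall_inP hx.
  by apply/eqP/h => i /hx/eqP.
move=> x v hv; have /eqP-> : d x == c j x; last exact: hv.
apply: (forall_inP h); rewrite inE; apply/forall_inP => i si.
by rewrite !hv.
Qed.

(* Acyclic carriers: a chain map from the simplex on the [c i], whose faces [s] have
   dimension [#|s|.-1]. *)
Lemma carried_chain_map : exists phi : {set 'I_k} -> cube T -> bool,
  forall s, [/\ carried (hull s) (phi s),
    forall q, phi s q -> (cube_dim q).+1 = #|s|,
    forall q, bd (phi s) q = \sum_(i in s) phi (s :\ i) q &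
    aug (phi s) = (#|s| == 1)%N].
Proof.
suff H m : exists phi : {set 'I_k} -> cube T -> bool,
  forall s, (#|s| <= m)%N -> [/\ carried (hull s) (phi s),
    forall q, phi s q -> (cube_dim q).+1 = #|s|,
    forall q, bd (phi s) q = \sum_(i in s) phi (s :\ i) q &
    aug (phi s) = (#|s| == 1)%N].
  by have [phi h] := H #|'I_k|; exists phi => s; apply/h/max_card.
elim: m => [|m [phi IH]].
  exists (fun _ _ => 0) => s; rewrite leqn0 cards_eq0 => /eqP ->; split=> //.
  - by move=> q; rewrite bd0 big_set0.
  - by rewrite cards0 /aug big1.
(* The faces with [m.+1] vertices are filled independently of each other; finite choice then
   assembles the next map, unchanged on smaller faces. *)
have step s : exists b, [/\ (#|s| <= m)%N -> b = phi s & #|s| = m.+1 ->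
  [/\ carried (hull s) b, forall q, b q -> (cube_dim q).+1 = #|s|,
    forall q, bd b q = \sum_(i in s) phi (s :\ i) q & aug b = (#|s| == 1)%N]].
  have [sm|sm] := leqP #|s| m; first by exists (phi s); split=> // e; lia.
  have [es|] := eqVneq #|s| m.+1; last by exists (phi s); split=> //; lia.
  have sD i : i \in s -> #|s :\ i| = m.
    by move=> si; move: (cardsD1 i s); rewrite si es => -[].
  case: (posnP m) => [m0|m_gt0].
    have /cards1P[i si] : #|s| == 1%N by rewrite es m0.
    exists (pred1 (vertex (c i))); split; first by lia.
    move=> _; split.
    - by apply/carried_vertex/mem_hull; rewrite si set11.
    - move=> q /= /eqP ->; rewrite si cards1 /cube_dim; congr _.+1.
      by apply/eqP; rewrite cards_eq0; apply/eqP/setP => x; rewrite !inE ffunE.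
    (* The only face is empty, and its image is zero because no cube satisfies
       [(cube_dim q).+1 = 0]. *)
    - move=> q; rewrite bd_vertex big1 // => j js; have := sD j js.
      rewrite m0 => /eqP; rewrite cards_eq0 => /eqP ->.
      have [_ h _ _] := IH set0 (leq_trans (eq_leq (cards0 _)) (leq0n _)).
      by apply: eq0_bool => /h; rewrite cards0.
    - by rewrite aug_vertex si cards1.
  pose a q := \sum_(i in s) phi (s :\ i) q.
  have IHs i : i \in s -> _ := fun si => IH (s :\ i) (eq_leq (sD i si)).
  have [|||||b [hb db bdb]] := @ample_acyclic_dim (hull s) a m.-1.
  - by apply: ample_hull; rewrite -card_gt0 es.
  - move=> q /sum_bool_exists[i si]; have [h _ _ _] := IHs i si => /h.
    by apply: cubical_sub; apply: hullS; apply: subsetDl.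
  - move=> q /sum_bool_exists[i si]; have [_ h _ _] := IHs i si => /h.
    by rewrite sD //; lia.
  - move=> q; rewrite bd_sum.
    under eq_bigr => i si do have [_ _ -> _] := IHs i si.
    rewrite pair_big_dep big_mkcond /=.
    apply: (sum_involution (t := fun p => (p.2, p.1))) => [[] //|[i j]|[i j] [-> _]] /=.
      by rewrite !inE eq_sym; case: (i \in s); case: (j \in s); rewrite ?andbF //=
        setDDl setUC -setDDl.
    by rewrite !inE eqxx andbF.
  (* Only an edge, [m = 1], has faces of nonzero augmentation, and its two ends cancel. *)
  - rewrite aug_sum.
    under eq_bigr => i si do have [_ _ _ ->] := IHs i si.
    under eq_bigr => i si do rewrite sD //.
    by rewrite sumr_const es; have [->|] := eqVneq m 1%N; rewrite ?mul0rn.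
  exists b; split; first by lia.
  move=> _; split=> //.
  - by move=> q /db ->; rewrite es; lia.
  - rewrite es /aug big1; first by case: eqP => //; lia.
    move=> d _; apply: eq0_bool => /db.
    rewrite /cube_dim (_ : [set _ | _] = set0) ?cards0 //.
    by apply/setP => x; rewrite !inE ffunE.
have [psi hpsi] := fin_all_exists step; exists psi => s sm.
have psiE t : (#|t| <= m)%N -> psi t = phi t by case: (hpsi t).
have sumE q : (#|s| <= m.+1)%N ->
    \sum_(i in s) psi (s :\ i) q = \sum_(i in s) phi (s :\ i) q.
  move=> _; apply: eq_bigr => i si; rewrite psiE //.
  by move: (cardsD1 i s); rewrite si; lia.
have [sm'|sm'] := leqP #|s| m.
  rewrite psiE //; have [h1 h2 h3 h4] := IH s sm'; split=> // q.
  by rewrite sumE.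
have [_ [|h1 h2 h3 h4]] := hpsi s; first by lia.
by split=> // q; rewrite sumE.
Qed.

End Carrier.

(** * Chains on the deleted product and the Borsuk-Ulam descent *)

Section DeletedProduct.

Variable T : finType.
Implicit Types (q r : cube T) (g h : cube T -> cube T -> bool).

Definition disjoint_cubes q r :=
  [exists x, [&& q x != None, r x != None & q x != r x]].

Lemma disjoint_cubes_sym q r : disjoint_cubes q r = disjoint_cubes r q.
Proof.
by apply: eq_existsb => x; rewrite andbCA eq_sym [None == _]eq_sym [r x == q x]eq_sym.
Qed.

Lemma disjoint_cubes_neq q r : disjoint_cubes q r -> q != r.
Proof. by case/existsP => x /and3P[_ _]; apply: contraNneq => ->. Qed.

Lemma disjoint_cubes_face q r x :
  disjoint_cubes (upd q x None) r -> disjoint_cubes q r.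
Proof.
case/existsP => y; have [->|yx] := eqVneq y x; first by rewrite updx.
by rewrite upd_neq // => h; apply/existsP; exists y.
Qed.

(** A function of two cubes is a mod 2 chain of product cells; [bd2] is the product boundary, which
    carries no signs mod 2. *)
Definition deleted g := forall q r, g q r -> disjoint_cubes q r.

Definition bd2 g q r := bd (g^~ r) q + bd (g q) r.

Definition aug2 g := aug (fun q => aug (g q)).

Lemma eq_bd2 g h : (forall q r, g q r = h q r) -> forall q r, bd2 g q r = bd2 h q r.
Proof. by move=> gh q r; rewrite /bd2; congr (_ + _); apply: eq_bd => s; rewrite gh. Qed.

Lemma bd2D g h q r : bd2 (fun q r => g q r + h q r) q r = bd2 g q r + bd2 h q r.
Proof. by rewrite /bd2 !bdD addrACA. Qed.

Lemma aug2D g h : aug2 (fun q r => g q r + h q r) = aug2 g + aug2 h.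
Proof. by rewrite /aug2 -augD; apply: eq_aug => q; rewrite augD. Qed.

Lemma aug2_tr g : aug2 (fun q r => g r q) = aug2 g.
Proof. exact: exchange_big. Qed.

Lemma aug2_bd2 g : aug2 (bd2 g) = 0.
Proof.
rewrite /bd2 aug2D /aug2; have -> : aug (fun q => aug (bd (g q))) = 0.
  by rewrite /aug big1 // => c _; apply: aug_bd.
by rewrite addr0 /aug exchange_big big1 // => c _; apply: aug_bd.
Qed.

Lemma bd2_tr g q r : bd2 (fun q r => g r q) q r = bd2 g r q.
Proof. by rewrite /bd2 addrC. Qed.

Lemma bd2_bd2 g q r : bd2 (bd2 g) q r = 0.
Proof.
rewrite /bd2 !bdD; set a := bd _ q; set b := bd _ q; set c := bd _ r; set d := bd _ r.
have -> : a = 0 by apply: bdbd.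
have -> : d = 0 by apply: bdbd.
rewrite add0r addr0 (_ : b = c) ?addrr_bool //.
exact: exchange_big.
Qed.

Lemma deleted_bd2 g : deleted g -> deleted (bd2 g).
Proof.
move=> dg q r; rewrite /bd2 /bd.
case e: (\sum_(x | q x != None) _) => [|].
  by move=> _; have [x _ /dg/disjoint_cubes_face] := sum_bool_exists e.
rewrite add0r => /sum_bool_exists[x _ /dg].
by rewrite disjoint_cubes_sym => /disjoint_cubes_face; rewrite disjoint_cubes_sym.
Qed.

(* The exchange of factors acts freely on the cells of the deleted product. *)
Lemma symmetric_split g :
  deleted g -> (forall q r, g q r = g r q) ->
  exists2 h, deleted h & forall q r, g q r = h q r + h r q.
Proof.
move=> dg gs; exists (fun q r => (enum_rank q < enum_rank r)%N && g q r).
  by move=> q r /andP[_ /dg].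
move=> q r; rewrite [g r q]gs; case gqr: (g q r); last by rewrite !andbF.
have := disjoint_cubes_neq (dg _ _ gqr); rewrite -(inj_eq enum_rank_inj) -val_eqE /=.
by rewrite !andbT; case: ltngtP.
Qed.

(* Mod 2 Borsuk-Ulam, with [H i] the image of a hemisphere of dimension [i]:
   descending from [n], each [H i] is a boundary plus a symmetrised chain. *)
Lemma hemisphere_descent (H : nat -> cube T -> cube T -> bool) n :
  (forall i, (i <= n)%N -> deleted (H i)) ->
  (forall i, (i < n)%N -> forall q r, bd2 (H i.+1) q r = H i q r + H i r q) ->
  (forall q r, H n q r = H n r q) ->
  aug2 (H 0%N) = 0.
Proof.
move=> dH bdH Hn.
(* The invariant says that [H m] is symmetric up to a boundary. It holds at [m = n] with [g = 0]; at
   [m = 0] it makes [H 0] plus a boundary of the form [h] plus its transpose, of augmentation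
   zero. *)
suff D m : (m <= n)%N -> (exists2 g, deleted g & forall q r,
    H m q r + bd2 g q r = H m r q + bd2 g r q) -> aug2 (H 0%N) = 0.
  apply: (D n (leqnn n)); exists (fun _ _ => 0) => // q r.
  by rewrite /bd2 !bd0 !addr0.
elim: m => [|m IH] ltm [g dg gs].
  have [|h dh hE] := @symmetric_split (fun q r => H 0%N q r + bd2 g q r) _ gs.
    move=> q r /=; case e: (H 0%N q r); first by move=> _; apply: dH e; apply: leq0n.
    by rewrite add0r; apply: deleted_bd2.
  have : aug2 (fun q r => H 0%N q r + bd2 g q r) = 0.
    rewrite (_ : aug2 _ = aug2 (fun q r => h q r + h r q)).
      by rewrite aug2D aug2_tr addrr_bool.
    by apply: eq_aug => q; apply: eq_aug => r; apply: hE.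
  by rewrite aug2D aug2_bd2 addr0.
have [|h dh hE] := @symmetric_split (fun q r => H m.+1 q r + bd2 g q r) _ gs.
  move=> q r /=; case e: (H m.+1 q r); first by move=> _; apply: dH e; apply: ltm.
  by rewrite add0r; apply: deleted_bd2.
(* Applying [bd2] to the splitting of [H m.+1 + bd2 g] gives [H m] plus its transpose on one side
   and [bd2 h] plus its transpose on the other, so [h] is the next correction. *)
apply: IH (ltnW ltm) _; exists h => // q r.
have := eq_bd2 hE q r; rewrite (bd2D (H m.+1)) (bd2D h) bd2_bd2 addr0 bdH // (bd2_tr h).
by case: (H m q r); case: (H m r q); case: (bd2 h q r); case: (bd2 h r q).
Qed.

End DeletedProduct.

(** * Hemispheres in the deleted product of a simplex *)

Section SimplexDeletedProduct.

Variables (T I : finType) (phi : {set I} -> cube T -> bool).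
Hypothesis bd_phi : forall s q, bd (phi s) q = \sum_(i in s) phi (s :\ i) q.
Implicit Types (U s : {set I}) (q r : cube T).

(* The deleted product of the simplex on [e |: U] is a sphere; this is the half of
   its image where [e] lies in the second factor. *)
Definition hemisphere U e q r :=
  \sum_(s : {set I} | s \subset U) (phi s q && phi (e |: (U :\: s)) r).

(** The image of the fundamental cycle: top cells of the deleted product of the simplex on [U] are
    pairs of complementary faces. *)
Definition sphere U q r :=
  \sum_(s : {set I} | s \subset U) (phi s q && phi (U :\: s) r).

(** Removing [e] from the second factor yields the sphere. Removing [i] in [U] from either factor
    yields all splittings of [U :\ i], so these terms occur twice and cancel. *)
Lemma bd_hemisphere U e q r :
  e \notin U -> bd2 (hemisphere U e) q r = sphere U q r.
Proof.
move=> eU; rewrite /bd2 /hemisphere !bd_sum.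
pose F s t := phi s q && phi (e |: t) r.
have -> : \sum_(s : {set I} | s \subset U)
    bd (fun r0 => phi s r0 && phi (e |: (U :\: s)) r) q =
    \sum_(s : {set I} | s \subset U) \sum_(i in s) F (s :\ i) (U :\: s).
  apply: eq_bigr => s _; rewrite -andb_suml -bd_phi /bd andb_suml.
  exact: eq_bigr.
have -> : \sum_(s : {set I} | s \subset U)
    bd (fun r0 => phi s q && phi (e |: (U :\: s)) r0) r =
    sphere U q r +
    \sum_(s : {set I} | s \subset U) \sum_(i in U :\: s) F s ((U :\: s) :\ i).
  rewrite /sphere -big_split; apply: eq_bigr => s _ /=.
  have es : e \notin U :\: s by rewrite inE (negbTE eU) andbF.
  transitivity (phi s q && bd (phi (e |: (U :\: s))) r).
    by rewrite /bd andb_sumr.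
  rewrite bd_phi big_setU1 //= setU1K // -andb_sumr; case: (phi s q) => //=.
  congr (_ + _); apply: eq_bigr => i iU; congr (phi _ r).
  rewrite setDUl; congr (_ :|: _); apply/setDidPl.
  by rewrite disjoints1 inE; apply: contraNneq es => ->.
rewrite (sum_subset_compl U (fun s t => \sum_(i in t) F s (t :\ i))).
rewrite (sum_subset_remove U F) (sum_subset_remove U (fun s t => F t s)).
set A := \sum_(i in U) _; set B := \sum_(i in U) _.
have -> : A = B by apply: eq_bigr => i _; apply: sum_subset_compl.
by rewrite addrCA addrr_bool addr0.
Qed.

Lemma sphere_hemispheres U e q r :
  e \notin U -> sphere (e |: U) q r = hemisphere U e q r + hemisphere U e r q.
Proof.
move=> eU; rewrite /sphere (bigID (fun s => e \notin s)) /=; congr (_ + _).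
  apply: eq_big => [s|s /andP[_ es]].
    apply/andP/idP => [[/subsetP sU es]|/subsetP sU].
      apply/subsetP => i si; have /setU1P[ie|//] := sU i si.
      by rewrite -ie si in es.
    split; last by apply: contra eU => /sU.
    by apply/subsetP => i /sU; rewrite inE orbC => ->.
  congr (_ && phi _ _); rewrite setDUl; congr (_ :|: _).
  by apply/setDidPl; rewrite disjoints1.
rewrite /hemisphere (sum_subset_compl U (fun s t => phi s r && phi (e |: t) q)).
rewrite (reindex_onto (fun s => e |: s) (fun s => s :\ e)) /=; last first.
  by move=> s /andP[_]; rewrite negbK => es; rewrite setD1K.
apply: eq_big => [s|s /andP[/andP[_ _] /eqP es]].
  rewrite negbK setU11 andbT; apply/andP/idP => [[/subsetP sU /eqP se]|/subsetP sU].
    apply/subsetP => i si; have /setU1P[ie|//] := sU i (setU1r _ si).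
    by move: si; rewrite ie -se !inE eqxx.
  split; first by apply/setUS/subsetP.
  by rewrite setU1K //; apply: contra eU => /sU.
rewrite andbC; congr (phi _ _ && _); apply/setP => i; rewrite !inE.
by have [->|] := eqVneq i e; rewrite //= (negbTE eU) andbF.
Qed.

(* If [phi] vanishes above the middle dimension, coning from [e] rewrites the top
   hemisphere as a visibly symmetric sum. *)
Lemma hemisphere_sym U e d q r :
  e \notin U -> #|U| = (2 * d).+1 ->
  (forall s q, (d.+1 < #|s|)%N -> phi s q = 0) ->
  hemisphere U e q r = hemisphere U e r q.
Proof.
move=> eU cU phi0.
suff E q' r' : hemisphere U e q' r' = \sum_(i in U) \sum_(s : {set I} | s \subset U :\ i)
    (phi (e |: s) q' && phi (e |: ((U :\ i) :\: s)) r').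
  rewrite !E; apply: eq_bigr => i _.
  rewrite (sum_subset_compl _ (fun s t => phi (e |: s) q && phi (e |: t) r)).
  by apply: eq_bigr => s _; rewrite andbC.
rewrite -(sum_subset_remove U (fun s t => phi (e |: s) q' && phi (e |: t) r')).
apply: eq_bigr => s sU; rewrite -andb_suml.
case pr: (phi (e |: (U :\: s)) r'); last by rewrite !andbF.
rewrite !andbT.
have es : e \notin s by apply: contra eU => /(subsetP sU).
(* Since [U] has [2 * d + 1] points, [s] and its complement cannot both have at most [d]; a nonzero
   second factor forces the complement to, so [s] has more. *)
have cs : (d.+1 < #|e |: s|)%N.
  rewrite cardsU1 es ltnNge; apply/negP => les.
  suff : phi (e |: (U :\: s)) r' = 0 by rewrite pr.
  apply: phi0; rewrite cardsU1 inE (negbTE eU) andbF cardsD (setIidPr sU); lia.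
(* The face [e |: s] has zero image, so its boundary relation expresses [phi s] through the faces
   containing [e]. *)
have : bd (phi (e |: s)) q' = 0.
  by rewrite /bd big1 // => x _; apply: phi0.
rewrite bd_phi big_setU1 //= setU1K // => /addr_eq0_bool ->.
apply: eq_bigr => i si; congr (phi _ q'); rewrite setDUl; congr (_ :|: _).
by apply/setDidPl; rewrite disjoints1 inE; apply: contraNneq es => ->.
Qed.

End SimplexDeletedProduct.

(** * The two bounds on the dual VC dimension *)

Lemma vc_attained (T : finType) (C : concept_class T) :
  exists2 X : {set T}, shatters C X & vc C = #|X|.
Proof.
have [|X XC e] := @eq_bigmax_cond _ (fun X => shatters C X) (fun X : {set T} => #|X|).
  by apply/card_gt0P; exists set0; rewrite unfold_in /shatters eqxx.
by exists X.
Qed.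

Section DualVC.

Variable T : finType.
Implicit Types (C : concept_class T).

Definition dually_shattered k (c : 'I_k -> {ffun T -> bool}) :=
  forall s : {set 'I_k}, exists x, forall i, c i x = (i \in s).

Lemma ample_dually_shattered C k (c : 'I_k -> {ffun T -> bool}) :
  ample C -> (forall i, c i \in C) -> dually_shattered c ->
  k <> (2 * vc C + 2)%N.
Proof.
move=> aC cC cS ek; set d := vc C in ek.
have {}ek : k = (2 * d).+2 by rewrite ek; lia.
subst k; have [phi phiP] := carried_chain_map aC cC.
have bd_phi (s : {set _}) q : bd (phi s) q = \sum_(i in s) phi (s :\ i) q
  by case: (phiP s).
have phi_dim (s : {set _}) q : (d.+1 < #|s|)%N -> phi s q = 0.
  move=> ds; apply: eq0_bool => pq; have [/(_ _ pq) hq /(_ _ pq) dq _ _] := phiP s.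
  have := cubical_dim_vc (cubical_sub (hull_sub C c s) hq); rewrite -/d; lia.
have phi_val (s : {set _}) q x v :
    phi s q -> (forall i, i \in s -> c i x = v) -> q x = Some v.
  move=> pq sv; have [/(_ _ pq) hq _ _ _] := phiP s.
  by apply: cubical_const hq _ => f /hullP[_]; apply.
(* The coordinate realising the pattern [s] is constantly true on the hull of [s] and false on that
   of [t]. *)
have phi_disj (s t : {set _}) q r :
    [disjoint s & t] -> phi s q -> phi t r -> disjoint_cubes q r.
  move=> st pq pr; have [x xP] := cS s; apply/existsP; exists x.
  rewrite (phi_val s q x true) // ?(phi_val t r x false) // => i it; rewrite xP //.
  by apply/negbTE; rewrite (disjointFl st).
(* The vertices are added one at a time: the hemisphere of dimension [j] uses the first [j.+1]
   vertices and the next one as [e], so that of dimension [2 * d] uses all of them. *)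
pose U m := [set i : 'I_(2 * d).+2 | (i < m)%N].
pose e m : 'I_(2 * d).+2 := inord m.
have eU m : (m < (2 * d).+2)%N -> e m \notin U m by move=> lm; rewrite inE inordK ?ltnn.
have US m : (m < (2 * d).+2)%N -> U m.+1 = e m |: U m.
  move=> lm; apply/setP => i; rewrite !inE ltnS leq_eqVlt; congr (_ || _).
  by rewrite -val_eqE /= inordK.
have cardU m : (m <= (2 * d).+2)%N -> #|U m| = m.
  elim: m => [|m IH] lm; last by rewrite US // cardsU1 eU // IH // ltnW.
  by apply/eqP; rewrite cards_eq0; apply/eqP/setP => i; rewrite !inE.
(* The hemisphere of dimension zero is one pair of points, of augmentation 1; the splitting with
   empty [s] drops out since [phi set0] vanishes. *)
have H0 q r :
    hemisphere phi (U 1%N) (e 1%N) q r = phi [set e 0%N] q && phi [set e 1%N] r.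
  have -> : U 1%N = [set e 0%N].
    by rewrite US // (_ : U 0%N = set0) ?setU0 //; apply/setP => i; rewrite !inE.
  rewrite /hemisphere (bigD1 [set e 0%N]) //= setDv setU0 big1 ?addr0 // => s.
  rewrite subset1 => /andP[/orP[/eqP->|/eqP->]]; first by rewrite eqxx.
  move=> _; case pq: (phi set0 q) => //.
  by have [_ /(_ _ pq) + _ _] := phiP set0; rewrite cards0.
have aug1 : aug2 (hemisphere phi (U 1%N) (e 1%N)) = 1.
  transitivity (aug (phi [set e 0%N]) && aug (phi [set e 1%N])).
    rewrite /aug2 {1}/aug {2}/aug andb_suml; apply: eq_bigr => f _.
    by rewrite /aug andb_sumr; apply: eq_bigr => g _; rewrite H0.
  by case: (phiP [set e 0%N]) (phiP [set e 1%N]) => _ _ _ -> [_ _ _ ->]; rewrite !cards1.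
suff : aug2 (hemisphere phi (U 1%N) (e 1%N)) = 0 by rewrite aug1.
apply: (hemisphere_descent
  (H := fun j => hemisphere phi (U j.+1) (e j.+1)) (n := 2 * d)).
- move=> j lj q r /sum_bool_exists[s sU /andP[pq pr]]; apply: phi_disj pq pr.
  have es : e j.+1 \notin s by apply: contra (subsetP sU _) (eU _ _).
  rewrite -setI_eq0; apply/eqP/setP => i; rewrite !inE.
  by have [->|_] := eqVneq i (e j.+1); [rewrite (negbTE es) | case: (i \in s)].
- move=> j lj q r; rewrite bd_hemisphere ?eU //.
  by rewrite US ?ltnS 1?ltnW // sphere_hemispheres ?eU // ltnS ltnW.
- by move=> q r; apply: (hemisphere_sym bd_phi (d := d)); rewrite ?eU ?cardU.
Qed.

Lemma shatters_shset C (X : {set T}) : C != set0 -> shatters C X = (X \in shset C).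
Proof.
case/set0Pn => c cC; rewrite /shatters inE.
have [->|//] := eqVneq X set0; apply/esym/forallP => f.
by apply/exists_inP; exists c => //; apply/forall_inP => x; rewrite inE.
Qed.

Lemma extremal_neq0 C : extremal C -> C != set0.
Proof.
move=> eC; rewrite -card_gt0 eC; apply/card_gt0P; exists set0.
by rewrite inE /shatters eqxx.
Qed.

Lemma extremal_ample C : extremal C -> ample C.
Proof.
move=> eC; rewrite /ample eC; apply: eq_card => X; rewrite inE.
by rewrite shatters_shset ?extremal_neq0.
Qed.

Lemma dual_vc_le C : extremal C -> (dual_vc C <= 2 * vc C + 1)%N.
Proof.
move=> eC; rewrite leqNgt; apply/negP; rewrite /dual_vc.
have [Y + ->] := vc_attained (dual_class C).
set k := (2 * vc C + 2)%N => sY ltY.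
have leY : (k <= #|Y|)%N by rewrite /k; lia.
(* The first [k] elements of [Y] suffice, since subfamilies of a shattered family realise all
   patterns. *)
pose c (i : 'I_k) := enum_val (widen_ord leY i).
have c_inj : injective c by move=> i j /enum_val_inj/(congr1 val)/= /val_inj.
have Y0 : Y != set0 by rewrite -card_gt0; lia.
case: (@ample_dually_shattered C k (fun i => val (c i))) => //.
- exact: extremal_ample.
- by move=> i; apply: valP.
move=> s; pose f := [ffun y : {c : {ffun T -> bool} | c \in C} => y \in c @: s].
move: sY; rewrite /shatters (negbTE Y0) => /forallP/(_ f)/exists_inP[_ /imsetP[x _ ->]].
move/forall_inP => h; exists x => i.
have /eqP := h (c i) (enum_valP _); rewrite !ffunE => ->.
by rewrite mem_imset.
Qed.

Lemma dual_vc_ge C : (trunc_log 2 (vc C) <= dual_vc C)%N.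
Proof.
have [->|d_gt0] := posnP (vc C); first by rewrite trunc_log0.
have [X] := vc_attained C; set k := trunc_log 2 (vc C) => sX eX.
have leX : (#|{set 'I_k}| <= #|X|)%N.
  by rewrite -cardsT -powersetT card_powerset cardsT card_ord -eX trunc_logP.
(* Distinct points of [X] are indexed by the subsets of ['I_k]; the concept [c i] chosen below
   labels the point of [s] by whether [i] lies in [s]. *)
pose g (s : {set 'I_k}) := enum_val (widen_ord leX (enum_rank s)).
have g_inj : injective g.
  by move=> s t /enum_val_inj/(congr1 val)/= /val_inj/enum_rank_inj.
have X0 : X != set0 by rewrite -card_gt0 -eX.
have cP (i : 'I_k) : exists c : {c | c \in C}, forall s, val c (g s) = (i \in s).
  move: sX; rewrite /shatters (negbTE X0) => /forallP.
  move/(_ [ffun x => [exists s, (g s == x) && (i \in s)]])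
    /exists_inP => -[c cC /forall_inP h].
  exists (exist _ c cC) => s /=; have /eqP-> := h (g s) (enum_valP _).
  rewrite ffunE; apply/existsP/idP => [[t /andP[/eqP/g_inj-> //]]|si].
  by exists s; rewrite eqxx.
have [c {}cP] := fin_all_exists cP.
have c_inj : injective c.
  (* The point indexed by a singleton separates its concept from all the others. *)
  move=> i j eij; have := cP i [set i]; rewrite eij cP !inE eqxx => /eqP//.
have -> : k = #|c @: [set: 'I_k]| by rewrite card_imset // cardsT card_ord.
apply: (@leq_bigmax_cond _ _ (fun Y : {set _} => #|Y|)).
apply/orP; right; apply/forallP => f.
pose s := [set i | f (c i)].
apply/exists_inP; exists [ffun y : {c : {ffun T -> bool} | c \in C} => val y (g s)].
  exact: imset_f.
by apply/forall_inP => _ /imsetP[i _ ->]; rewrite ffunE cP inE.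
Qed.

End DualVC.

Local Close Scope ring_scope.

Theorem theoremB (n : nat) (C : concept_class 'I_n) (hC : extremal C) :
  trunc_log 2 (vc C) <= dual_vc C /\ dual_vc C <= 2 * vc C + 1.
Proof. by split; [apply: dual_vc_ge | apply: dual_vc_le]. Qed.
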